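(* Let $(\mathfrak{g},\langle\cdot,\cdot\rangle)$ be a completely solvable unimodular Lorentzian Lie algebra such that the derived algebra $[\mathfrak{g},\mathfrak{g}]$ is degenerate (the restriction of $\langle\cdot,\cdot\rangle$ to it is degenerate). Then $\mathfrak{g}$ is Einstein if and only if it is (isometrically isomorphic to a Lorentzian Lie algebra) obtained by a double extension process from an abelian Euclidean Lie algebra with admissible parameters $(K,D,-\mathrm{tr}(D),b)$. In particular, if $\mathfrak{g}$ is Einstein then it is Ricci-flat.
   Context: A Lorentzian Lie algebra is a finite-dimensional real Lie algebra with a nondegenerate symmetric bilinear form of signature $(1,n-1)$. $\mathfrak{g}$ is completely solvable if there is a chain of ideals $0=I_0\subset I_1\subset\cdots\subset I_n=\mathfrak{g}$ with $\dim I_i=i$; unimodular means $\mathrm{tr}(\mathrm{ad}_u)=0$ for all $u$. Double extension of a Euclidean Lie algebra $(\mathfrak{g}_0,[\cdot,\cdot]_0,\langle\cdot,\cdot\rangle_0)$ with parameters $(K,D,\mu,b)$ ($K,D$ endomorphisms of $\mathfrak{g}_0$, $K$ skew-symmetric, $\mu\in\mathbb{R}$, $b\in\mathfrak{g}_0$): $\mathfrak{g}=\mathbb{R}e\oplus\mathfrak{g}_0\oplus\mathbb{R}\bar e$ with $\langle e,e\rangle=\langle\bar e,\bar e\rangle=0$, $\langle e,\bar e\rangle=1$, $\mathfrak{g}_0\perp\{e,\bar e\}$, $\langle\cdot,\cdot\rangle|_{\mathfrak{g}_0}=\langle\cdot,\cdot\rangle_0$, and skew-symmetric bracket $[\bar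 e,e]=\mu e$, $[\bar e,u]=D(u)+\langle b,u\rangle_0e$, $[u,v]=[u,v]_0+\langle K(u),v\rangle_0e$, $[e,u]=0$ ($u,v\in\mathfrak{g}_0$). For $\mathfrak{g}_0$ abelian, the parameters are called admissible when this bracket is a Lie bracket and the resulting Lorentzian Lie algebra is Einstein; equivalently, $KD+D^*K=\mu K$ and $4\mu\,\mathrm{tr}(D)-2\mathrm{tr}(D^2)-2\mathrm{tr}(DD^* )-\mathrm{tr}(K^2)=0$ (adjoints with respect to $\langle\cdot,\cdot\rangle_0$). Einstein means the Ricci operator $\mathrm{Ric}$ of the Levi-Civita connection (given by $2\langle \mathrm{L}_uv,w\rangle=\langle[u,v],w\rangle+\langle[w,u],v\rangle+\langle[w,v],u\rangle$, curvature $\mathrm{L}_{[u,v]}-[\mathrm{L}_u,\mathrm{L}_v]$, $\langle\mathrm{Ric}(u),v\rangle=\mathrm{tr}(w\mapsto K(u,w)v)$) equals $\lambda\mathrm{Id}$ for some $\lambda$; Ricci-flat means $\mathrm{Ric}=0$. *)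

(* Defs.v *)
From HB Require Import structures.
From mathcomp Require Import all_boot all_order all_algebra.
From mathcomp Require Import reals.
Set Implicit Arguments. Unset Strict Implicit. Unset Printing Implicit Defensive.
Import Order.TTheory GRing.Theory Num.Theory.
Local Open Scope ring_scope.

Section Defs.
Variable R : realType.

Definition ebasis (n : nat) (i : 'I_n) : 'rV[R]_n := delta_mx 0 i.

(* a Lie bracket: bilinear (left-linear + skew gives bilinear), skew, Jacobi *)
Definition is_lie_bracket (n : nat) (br : 'rV[R]_n -> 'rV[R]_n -> 'rV[R]_n) :=
  [/\ (forall (a : R) u v w, br (a *: u + v) w = a *: br u w + br v w),
      (forall u v, br u v = - br v u) &
      (forall u v w, br u (br v w) + br v (br w u) + br w (br u v) = 0)].

Definition ipG (n : nat) (G : 'M[R]_n) (u v : 'rV[R]_n) : R := (u *m G *m v^T) 0 0.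

Definition lor_diag (n : nat) : 'M[R]_n :=
  \matrix_(i, j) (if i == j then (if val i == 0%N then -1 else 1) else 0).

Definition is_lorentzian (n : nat) (G : 'M[R]_n) :=
  [/\ (0 < n)%N, G^T = G &
      exists P : 'M[R]_n, P \in unitmx /\ P *m G *m P^T = lor_diag n].

Definition completely_solvable (n : nat) (br : 'rV[R]_n -> 'rV[R]_n -> 'rV[R]_n) :=
  exists I : nat -> 'M[R]_n,
    [/\ (forall i, (i <= n)%N -> \rank (I i) = i),
        (forall i, (i < n)%N -> (I i <= I i.+1)%MS) &
        (forall i u v, (i <= n)%N -> (u <= I i)%MS -> (br u v <= I i)%MS)].

Definition ad_mx (n : nat) (br : 'rV[R]_n -> 'rV[R]_n -> 'rV[R]_n) (u : 'rV[R]_n)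
  : 'M[R]_n := \matrix_(i, j) (br u (ebasis i)) 0 j.

Definition unimodular (n : nat) (br : 'rV[R]_n -> 'rV[R]_n -> 'rV[R]_n) :=
  forall u, \tr (ad_mx br u) = 0.

Definition derived (n : nat) (br : 'rV[R]_n -> 'rV[R]_n -> 'rV[R]_n) : 'M[R]_n :=
  (\sum_(i < n) \sum_(j < n) <<br (ebasis i) (ebasis j)>>)%MS.

Definition degenerate_on (n : nat) (G : 'M[R]_n) (S : 'M[R]_n) :=
  exists w : 'rV[R]_n, [/\ w != 0, (w <= S)%MS &
                           forall x, (x <= S)%MS -> ipG G w x = 0].

(* Levi-Civita product: 2<L_u v, w> = <[u,v],w> + <[w,u],v> + <[w,v],u> *)
Definition LC (n : nat) (br : 'rV[R]_n -> 'rV[R]_n -> 'rV[R]_n) (G : 'M[R]_n)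
  (u v : 'rV[R]_n) : 'rV[R]_n :=
  (2%:R^-1) *: ((\row_k (ipG G (br u v) (ebasis k) + ipG G (br (ebasis k) u) v
                          + ipG G (br (ebasis k) v) u)) *m invmx G).

Definition curv (n : nat) (br : 'rV[R]_n -> 'rV[R]_n -> 'rV[R]_n) (G : 'M[R]_n)
  (u v w : 'rV[R]_n) : 'rV[R]_n :=
  LC br G (br u v) w - (LC br G u (LC br G v w) - LC br G v (LC br G u w)).

Definition ric_form (n : nat) (br : 'rV[R]_n -> 'rV[R]_n -> 'rV[R]_n) (G : 'M[R]_n)
  (u v : 'rV[R]_n) : R := \sum_(k < n) (curv br G u (ebasis k) v) 0 k.

Definition Ric (n : nat) (br : 'rV[R]_n -> 'rV[R]_n -> 'rV[R]_n) (G : 'M[R]_n)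
  (u : 'rV[R]_n) : 'rV[R]_n :=
  (\row_j ric_form br G u (ebasis j)) *m invmx G.

Definition einstein (n : nat) (br : 'rV[R]_n -> 'rV[R]_n -> 'rV[R]_n) (G : 'M[R]_n) :=
  exists lambda : R, forall u, Ric br G u = lambda *: u.

Definition ricci_flat (n : nat) (br : 'rV[R]_n -> 'rV[R]_n -> 'rV[R]_n) (G : 'M[R]_n) :=
  forall u, Ric br G u = 0.

Definition isometric_iso (n N : nat)
  (br1 : 'rV[R]_n -> 'rV[R]_n -> 'rV[R]_n) (G1 : 'M[R]_n)
  (br2 : 'rV[R]_N -> 'rV[R]_N -> 'rV[R]_N) (G2 : 'M[R]_N) (P : 'M[R]_(n, N)) :=
  [/\ bijective (fun x : 'rV[R]_n => x *m P),
      (forall x y, br1 x y *m P = br2 (x *m P) (y *m P)) &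
      (forall x y, ipG G2 (x *m P) (y *m P) = ipG G1 x y)].

(* ---- Double extension of the abelian Euclidean Lie algebra (R^m, standard dot
   product).  A vector of R e (+) g0 (+) R ebar is stored in 'rV_(1 + m + 1) as
   (a, u, c) <-> a e + u + c ebar.  Endomorphisms of g0 act on row vectors:
   D(u) := u *m D, K(u) := u *m K. *)
Definition dot0 (m : nat) (u v : 'rV[R]_m) : R := (u *m v^T) 0 0.

Definition de_mk (m : nat) (a : R) (u : 'rV[R]_m) (c : R) : 'rV[R]_(1 + m + 1) :=
  row_mx (row_mx (a%:M : 'M[R]_1) u) (c%:M : 'M[R]_1).
Definition de_a (m : nat) (x : 'rV[R]_(1 + m + 1)) : R := (lsubmx (lsubmx x)) 0 0.
Definition de_u (m : nat) (x : 'rV[R]_(1 + m + 1)) : 'rV[R]_m := rsubmx (lsubmx x).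
Definition de_c (m : nat) (x : 'rV[R]_(1 + m + 1)) : R := (rsubmx x) 0 0.

(* bracket: [ebar,e] = mu e, [ebar,u] = D u + <b,u> e, [u,v] = <K u,v> e, [e,.] = 0 *)
Definition de_br (m : nat) (K D : 'M[R]_m) (mu : R) (b : 'rV[R]_m)
  (x y : 'rV[R]_(1 + m + 1)) : 'rV[R]_(1 + m + 1) :=
  let a := de_a x in let u := de_u x in let c := de_c x in
  let a' := de_a y in let v := de_u y in let c' := de_c y in
  de_mk (mu * (c * a' - a * c') + c * dot0 b v - c' * dot0 b u + dot0 (u *m K) v)
        (c *: (v *m D) - c' *: (u *m D)) 0.

Definition de_ip (m : nat) (x y : 'rV[R]_(1 + m + 1)) : R :=
  de_a x * de_c y + de_c x * de_a y + dot0 (de_u x) (de_u y).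
Definition de_G (m : nat) : 'M[R]_(1 + m + 1) :=
  \matrix_(i, j) de_ip (ebasis i) (ebasis j).

Definition admissible (m : nat) (K D : 'M[R]_m) (mu : R) (b : 'rV[R]_m) :=
  [/\ K^T = - K, is_lie_bracket (de_br K D mu b) & einstein (de_br K D mu b) (de_G m)].

End Defs.

(* Main.v *)
Require Import Defs.
From HB Require Import structures.
From mathcomp Require Import all_boot all_order all_algebra.
From mathcomp Require Import reals.
From mathcomp Require Import ring lra.
Import Order.TTheory GRing.Theory Num.Theory.
Local Open Scope ring_scope.
Set Implicit Arguments. Unset Strict Implicit. Unset Printing Implicit Defensive.

(** For a unimodular metric Lie algebra, completing the Levi-Civita product gives
    ric(u,v) = - tr(R_u R_v) with R_u = - (ad_u + ad_u^* + J_u) / 2, where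
    <J_u v, w> = <u, [v, w]>; hence
    ric(u,v) = - B(u,v)/2 - tr(ad_u ad_v^* )/2 - tr(J_u J_v)/4, B the Killing form.
    Let e be a null vector of [g,g] orthogonal to [g,g], completed to a frame
    (e, E_i, f) with e, f null, <e,f> = 1, (E_i) orthonormal and orthogonal to
    e and f.  Then J_e = 0, and B(e, .) = 0 because a common triangularization of
    the ad_u kills the diagonal of ad_e.  Writing w for the E-part of [e,f]:
    - ric(e,e) = 0 gives sum_i |[e,E_i]|^2 = 0, so [e,E_i] is a multiple of e;
    - ric(e,f) = lambda gives lambda = |w|^2 / 2;
    - summing ric(E_i,E_i) = lambda over the m indices i gives
      m lambda + |w|^2 / 2 + sum_i B(E_i,E_i) / 2
        + sum_ij |[E_i,E_j]|^2 / 4 = 0.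
    Every term of the last sum is nonnegative (B(u,u) is a sum of squares of
    real weights), so all of them vanish: lambda = 0, [e,f] and [E_i,E_j] are
    multiples of e, and the ad_(E_i) are nilpotent, whence [e,E_i] = 0.  This is
    the bracket of a double extension of an abelian algebra. *)


Lemma sum_ge0_eq0 (R : numDomainType) (I : finType) (F : I -> R) :
  (forall i, 0 <= F i) -> \sum_i F i = 0 -> forall i, F i = 0.
Proof. by move=> F0 sumF i; apply: (psumr_eq0P _ sumF). Qed.

Lemma sum_sqr_eq0 (R : realDomainType) (I : finType) (F : I -> R) :
  \sum_i F i ^+ 2 = 0 -> forall i, F i = 0.
Proof.
move=> sumF i; apply/eqP; rewrite -sqrf_eq0; apply/eqP.
by apply: (sum_ge0_eq0 _ sumF) => j; apply: sqr_ge0.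
Qed.

(** * Symmetric nondegenerate forms and adjoints *)

Section InnerProduct.
Variables (R : realType) (n : nat) (G : 'M[R]_n).
Implicit Types u v w : 'rV[R]_n.
Local Notation ip := (ipG G).

Lemma ipDl u v w : ip (u + v) w = ip u w + ip v w.
Proof. by rewrite /ipG !mulmxDl mxE. Qed.

Lemma ipZl a u w : ip (a *: u) w = a * ip u w.
Proof. by rewrite /ipG -!scalemxAl mxE. Qed.

Lemma ipNl u w : ip (- u) w = - ip u w.
Proof. by rewrite -scaleN1r ipZl mulN1r. Qed.

Lemma ip0l w : ip 0 w = 0.
Proof. by rewrite -(scale0r 0) ipZl mul0r. Qed.

Lemma ip_suml I (r : seq I) (P : pred I) (F : I -> 'rV[R]_n) w :
  ip (\sum_(i <- r | P i) F i) w = \sum_(i <- r | P i) ip (F i) w.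
Proof. by apply: (big_morph (fun u => ip u w)) => [u v|]; rewrite ?ipDl ?ip0l. Qed.

Hypothesis Gsym : G^T = G.

Lemma ipC u v : ip u v = ip v u.
Proof.
rewrite /ipG -[in LHS](trmxK u) -{1}Gsym -trmx_mul.
by rewrite -[v in LHS]trmxK -trmx_mul mxE !trmxK mulmxA.
Qed.

Lemma ipDr u v w : ip w (u + v) = ip w u + ip w v.
Proof. by rewrite !(ipC w) ipDl. Qed.

Lemma ipZr a u w : ip w (a *: u) = a * ip w u.
Proof. by rewrite !(ipC w) ipZl. Qed.

Lemma ipNr u w : ip w (- u) = - ip w u.
Proof. by rewrite !(ipC w) ipNl. Qed.

Lemma ip0r w : ip w 0 = 0.
Proof. by rewrite ipC ip0l. Qed.

Lemma ip_sumr I (r : seq I) (P : pred I) (F : I -> 'rV[R]_n) w :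
  ip w (\sum_(i <- r | P i) F i) = \sum_(i <- r | P i) ip w (F i).
Proof. by rewrite ipC ip_suml; apply: eq_bigr => i _; rewrite ipC. Qed.

Hypothesis Gunit : G \in unitmx.

Lemma ip_nondeg u v : (forall w, ip u w = ip v w) -> u = v.
Proof.
move=> uv; apply: (can_inj (mulmxK Gunit)); apply/rowP=> k.
by have := uv (ebasis R k); rewrite /ipG /ebasis trmx_delta -!colE !mxE.
Qed.

Lemma ip_mx_inj (A B : 'M[R]_n) :
  (forall u v, ip (u *m A) v = ip (u *m B) v) -> A = B.
Proof.
move=> AB; apply/row_matrixP => i; rewrite !rowE.
by apply: ip_nondeg => w; apply: AB.
Qed.

(** Solves [A *m G = G *m (adjmx A)^T], so it is the metric adjoint for endomorphisms acting on row
    vectors from the right. *)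
Definition adjmx (A : 'M[R]_n) := G *m A^T *m invmx G.

Lemma ip_adj A u v : ip (u *m A) v = ip u (v *m adjmx A).
Proof.
rewrite /ipG /adjmx !trmx_mul trmx_inv Gsym trmxK.
by rewrite !mulmxA mulmxK // -!mulmxA.
Qed.

Lemma adjmxM A B : adjmx (A *m B) = adjmx B *m adjmx A.
Proof. by rewrite /adjmx trmx_mul !mulmxA mulmxKV. Qed.

Lemma adjmxK A : adjmx (adjmx A) = A.
Proof.
rewrite /adjmx !trmx_mul trmxK trmx_inv Gsym.
by rewrite !mulmxA mulmxV // mul1mx mulmxK.
Qed.

Lemma mxtrace_adj A : \tr (adjmx A) = \tr A.
Proof. by rewrite /adjmx mxtrace_mulC mulmxA mulVmx // mul1mx mxtrace_tr. Qed.

End InnerProduct.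

(** * Adjoint maps, the Levi-Civita product and the unimodular Ricci form *)

Section Bracket.
Variables (R : realType) (n : nat) (br : 'rV[R]_n -> 'rV[R]_n -> 'rV[R]_n).
Hypothesis Lbr : is_lie_bracket br.
Implicit Types u v w : 'rV[R]_n.

Lemma brC u v : br u v = - br v u.
Proof. by case: Lbr. Qed.

Lemma brxx u : br u u = 0.
Proof.
have /eqP := brC u u; rewrite -addr_eq0 -mulr2n -scaler_nat scaler_eq0.
by rewrite pnatr_eq0 => /eqP.
Qed.

Lemma brZDl a u v w : br (a *: u + v) w = a *: br u w + br v w.
Proof. by case: Lbr. Qed.

Lemma brDl u v w : br (u + v) w = br u w + br v w.
Proof. by rewrite -[u]scale1r brZDl !scale1r. Qed.

Lemma br0l w : br 0 w = 0.
Proof. by apply: (addIr (br 0 w)); rewrite -brDl !add0r. Qed.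

Lemma brZl a u w : br (a *: u) w = a *: br u w.
Proof. by rewrite -[a *: u]addr0 brZDl br0l addr0. Qed.

Lemma brDr u v w : br w (u + v) = br w u + br w v.
Proof. by rewrite !(brC w) brDl opprD. Qed.

Lemma brZr a u w : br w (a *: u) = a *: br w u.
Proof. by rewrite !(brC w) brZl scalerN. Qed.

Lemma brNr u w : br w (- u) = - br w u.
Proof. by rewrite -scaleN1r brZr scaleN1r. Qed.

Lemma br0r w : br w 0 = 0.
Proof. by rewrite brC br0l oppr0. Qed.

Lemma br_suml I (r : seq I) (P : pred I) (F : I -> 'rV[R]_n) w :
  br (\sum_(i <- r | P i) F i) w = \sum_(i <- r | P i) br (F i) w.
Proof. by apply: (big_morph (fun u => br u w)) => [u v|]; rewrite ?brDl ?br0l. Qed.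

Lemma br_sumr I (r : seq I) (P : pred I) (F : I -> 'rV[R]_n) w :
  br w (\sum_(i <- r | P i) F i) = \sum_(i <- r | P i) br w (F i).
Proof. by apply: (big_morph (br w)) => [u v|]; rewrite ?brDr ?br0r. Qed.

Lemma row_sum_ebasis u : u = \sum_i u 0 i *: ebasis R i.
Proof. by rewrite {1}(row_sum_delta u). Qed.

Lemma br_ad u w : br u w = w *m ad_mx br u.
Proof.
rewrite {1}(row_sum_ebasis w) br_sumr mulmx_sum_row; apply: eq_bigr => i _.
by rewrite brZr; congr (_ *: _); apply/rowP => j; rewrite !mxE.
Qed.

Lemma br_derived u v : (br u v <= derived br)%MS.
Proof.
rewrite (row_sum_ebasis u) (row_sum_ebasis v) br_suml.
apply: summx_sub => i _; rewrite br_sumr; apply: summx_sub => j _.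
rewrite brZl brZr !scalemx_sub // /derived.
apply: submx_trans (sumsmx_sup i _ (submx_refl _)) => //.
by apply: (sumsmx_sup j) => //; rewrite genmxE.
Qed.

Lemma ad_mxZD a u v : ad_mx br (a *: u + v) = a *: ad_mx br u + ad_mx br v.
Proof. by apply/matrixP => i j; rewrite !mxE brZDl !mxE. Qed.

(** The Jacobi identity; the products come in reverse order because matrices act on row vectors from
    the right. *)
Lemma ad_mx_br u v :
  ad_mx br (br u v) = ad_mx br v *m ad_mx br u - ad_mx br u *m ad_mx br v.
Proof.
apply/row_matrixP => i; rewrite !rowE mulmxBr !mulmxA -!br_ad.
set w := delta_mx 0 i; case: Lbr => _ _ /(_ u v w).
by rewrite (brC w (br u v)) (brC w u) brNr => /eqP; rewrite subr_eq0 => /eqP.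
Qed.

Variable G : 'M[R]_n.
Local Notation ip := (ipG G).
Hypotheses (Gsym : G^T = G) (Gunit : G \in unitmx).

Lemma ip_LC u v w :
  ip (LC br G u v) w = 2%:R^-1 * (ip (br u v) w + ip (br w u) v + ip (br w v) u).
Proof.
rewrite /LC ipZl; congr (_ * _).
rewrite {1}/ipG mulmxKV // mxE.
under eq_bigr => k _ do rewrite !mxE.
rewrite [in RHS](row_sum_ebasis w) (ip_sumr Gsym) !br_suml !ip_suml -!big_split /=.
by apply: eq_bigr => k _; rewrite (ipZr Gsym) !brZl !ipZl; ring.
Qed.

(* The map J_u with <J_u v, w> = <u, [v, w]>. *)
Definition coad u : 'M[R]_n :=
  (\matrix_(i, j) ip u (br (ebasis R i) (ebasis R j))) *m invmx G.

Lemma ip_coad u v w : ip (v *m coad u) w = ip u (br v w).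
Proof.
rewrite {1}/ipG /coad mulmxA mulmxKV //.
rewrite {2}(row_sum_ebasis v) {2}(row_sum_ebasis w).
rewrite br_suml (ip_sumr Gsym) mxE.
under eq_bigr => j _ do rewrite !mxE big_distrl /=.
rewrite exchange_big; apply: eq_bigr => i _ /=.
rewrite br_sumr (ip_sumr Gsym); apply: eq_bigr => j _.
by rewrite brZl brZr !(ipZr Gsym) !mxE; ring.
Qed.

Lemma adj_coad u : adjmx G (coad u) = - coad u.
Proof.
apply: (ip_mx_inj Gunit) => v w.
rewrite (ipC Gsym) -(ip_adj Gsym Gunit) ip_coad mulmxN ipNl ip_coad.
by rewrite brC (ipNr Gsym).
Qed.

Lemma mxtrace_coad u : \tr (coad u) = 0.
Proof.
have : \tr (coad u) = - \tr (coad u).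
  by rewrite -[LHS](mxtrace_adj Gunit) adj_coad raddfN.
by lra.
Qed.

(** The map R_u: v to L_v u, right multiplication by [u] for the Levi-Civita product, read off the
    Koszul formula. *)
Definition LCr u : 'M[R]_n :=
  - 2%:R^-1 *: (ad_mx br u + adjmx G (ad_mx br u) + coad u).

Lemma LC_LCr u v : LC br G u v = u *m LCr v.
Proof.
apply: (ip_nondeg Gunit) => w; rewrite ip_LC /LCr -scalemxAr ipZl.
rewrite !mulmxDr !ipDl ip_coad -br_ad.
rewrite [ip (u *m adjmx G _) w](ipC Gsym) -(ip_adj Gsym Gunit) -br_ad.
rewrite (brC v u) (brC w u) (brC w v) !ipNl [ip v _](ipC Gsym).
by field.
Qed.

Lemma LC_torsion u v : LC br G u v - LC br G v u = br u v.
Proof.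
apply: (ip_nondeg Gunit) => w; rewrite ipDl ipNl !ip_LC.
by rewrite (brC v u) ipNl; field.
Qed.

Lemma LC_LCl u v : LC br G u v = v *m (LCr u + ad_mx br u).
Proof.
by rewrite mulmxDr -LC_LCr -br_ad -LC_torsion addrC subrK.
Qed.

(** The curvature as an endomorphism of its middle argument, so that the Ricci form becomes a matrix
    trace. *)
Definition curvmx u v : 'M[R]_n :=
  ad_mx br u *m LCr v - LCr v *m (LCr u + ad_mx br u) + LCr (LC br G u v).

Lemma curv_curvmx u w v : curv br G u w v = w *m curvmx u v.
Proof.
rewrite /curv /curvmx mulmxDr mulmxBr !mulmxA -br_ad -!LC_LCr.
by rewrite -LC_LCl opprD opprK addrA.
Qed.

Lemma ric_form_curvmx u v : ric_form br G u v = \tr (curvmx u v).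
Proof.
apply: eq_bigr => k _; rewrite curv_curvmx.
by rewrite -rowE [LHS]mxE.
Qed.

Hypothesis Ubr : unimodular br.

Lemma mxtrace_LCr u : \tr (LCr u) = 0.
Proof.
by rewrite /LCr mxtraceZ !mxtraceD (mxtrace_adj Gunit) mxtrace_coad Ubr !addr0 mulr0.
Qed.

(** In the trace of [curvmx], the last summand drops out by unimodularity and the two containing
    ad_u cancel by cyclicity. *)
Lemma ric_form_LCr u v : ric_form br G u v = - \tr (LCr u *m LCr v).
Proof.
rewrite ric_form_curvmx /curvmx mxtraceD mxtrace_LCr addr0 linearB /= mulmxDr mxtraceD.
by rewrite (mxtrace_mulC (ad_mx br u)) opprD addrCA subrr addr0 mxtrace_mulC.
Qed.

(** Adjoints preserve the trace and [coad] is skew-adjoint, so the products mixing [coad] with ad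
    and with its adjoint cancel in pairs. *)
Lemma ric_formE u v :
  ric_form br G u v =
    - 2%:R^-1 * \tr (ad_mx br u *m ad_mx br v)
    - 2%:R^-1 * \tr (ad_mx br u *m adjmx G (ad_mx br v))
    - 4%:R^-1 * \tr (coad u *m coad v).
Proof.
rewrite ric_form_LCr /LCr.
set A := ad_mx br u; set B := ad_mx br v; set J := coad u; set K := coad v.
have tr_adj X Y : \tr (adjmx G X *m Y) = \tr (X *m adjmx G Y).
  rewrite -(mxtrace_adj Gunit) (adjmxM Gunit) (adjmxK Gsym Gunit).
  by rewrite mxtrace_mulC.
have trKA : \tr (adjmx G A *m K) = - \tr (A *m K).
  by rewrite tr_adj adj_coad mulmxN raddfN.
have trJB : \tr (J *m adjmx G B) = - \tr (J *m B).
  by rewrite -tr_adj adj_coad mulNmx raddfN.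
have trAB : \tr (adjmx G A *m adjmx G B) = \tr (A *m B).
  by rewrite tr_adj (adjmxK Gsym Gunit).
rewrite -scalemxAl -scalemxAr !mxtraceZ !mulmxDl !mulmxDr !mxtraceD.
by rewrite trKA trJB trAB tr_adj; field.
Qed.

End Bracket.


(** * Flags, common triangularization and the Killing form *)

Section Flag.
Variables (F : fieldType) (n : nat) (I : nat -> 'M[F]_n).
Hypothesis rankI : forall i, (i <= n)%N -> \rank (I i) = i.
Hypothesis subI : forall i, (i < n)%N -> (I i <= I i.+1)%MS.

(** Row i of [Q] is any vector of [I i.+1] outside [I i]; by dimension count the first k rows span
    [I k]. *)
Lemma flag_basis : exists Q : 'M[F]_n,
  [/\ Q \in unitmx, forall i : 'I_n, (row i Q <= I i.+1)%MS &
      forall k, (k <= n)%N -> (I k <= \sum_(j < n | (j < k)%N) <<row j Q>>)%MS].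
Proof.
have exq (i : 'I_n) : exists q : 'rV[F]_n, (q <= I i.+1)%MS && ~~ (q <= I i)%MS.
  have /row_subPn[k qk] : ~~ (I i.+1 <= I i)%MS.
    apply/negP => /mxrankS.
    by rewrite !rankI ?ltnn // ltnW.
  by exists (row k (I i.+1)); rewrite qk row_sub.
have [q /= qP] := fin_all_exists exq.
have rowQ i : row i (\matrix_j q j) = q i by rewrite rowK.
have spanI k : (k <= n)%N ->
    (I k <= \sum_(j < n | (j < k)%N) <<row j (\matrix_j q j)>>)%MS.
  elim: k => [|k IH] kn.
    by move/eqP: (rankI kn); rewrite mxrank_eq0 => /eqP ->; exact: sub0mx.
  have /andP[q1 q2] := qP (Ordinal kn).
  (* Adding the new vector enlarges [I k] strictly inside [I k.+1], whose rank is only one more, so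
     the sum is all of [I k.+1]. *)
  have ltI : (I k < I k + q (Ordinal kn))%MS.
    rewrite ltmxE addsmxSl /=; apply: contra q2.
    by apply: submx_trans; apply: addsmxSr.
  have supI : (I k + q (Ordinal kn) <= I k.+1)%MS by rewrite addsmx_sub subI.
  have leI : (I k.+1 <= I k + q (Ordinal kn))%MS.
    rewrite -(mxrank_leqif_sup supI) eqn_leq mxrankS //= rankI //.
    by rewrite -[X in (X < _)%N](rankI (ltnW kn)) rank_ltmx.
  apply: submx_trans leI _; rewrite addsmx_sub; apply/andP; split.
    apply: submx_trans (IH (ltnW kn)) _; apply/sumsmx_subP => j jk.
    by apply: (sumsmx_sup j) => //; apply: ltnW.
  by apply: (sumsmx_sup (Ordinal kn)) => //=; rewrite genmxE rowQ.
exists (\matrix_j q j); split=> //; last first.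
  by move=> i; rewrite rowQ; case/andP: (qP i).
rewrite -row_full_unit -sub1mx.
apply: submx_trans (_ : I n <= _)%MS.
  by rewrite sub1mx /row_full rankI.
apply: submx_trans (spanI n (leqnn n)) _.
by apply/sumsmx_subP => j _; rewrite genmxE row_sub.
Qed.

End Flag.

Section CompletelySolvable.
Variables (R : realType) (n : nat) (br : 'rV[R]_n -> 'rV[R]_n -> 'rV[R]_n).
Hypothesis Lbr : is_lie_bracket br.
Hypothesis CS : completely_solvable br.

Lemma ad_trig : exists2 Q : 'M[R]_n, Q \in unitmx &
  forall u, is_trig_mx (Q *m ad_mx br u *m invmx Q).
Proof.
case: CS => I [rankI subI idI].
have [Q [Qu Qsub Qsup]] := flag_basis rankI subI.
exists Q => // u; apply/is_trig_mxP => i k ik.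
(* The kernel is that of the k-th coordinate in the basis [Q]; it contains [I i.+1], spanned by rows
   of index at most i < k, and this ideal contains the bracket. *)
have : (row i Q *m ad_mx br u <= kermx (invmx Q *m (delta_mx k 0 : 'cV_n)))%MS.
  rewrite -(br_ad Lbr) (brC Lbr) -scaleN1r; apply: scalemx_sub.
  apply: submx_trans (idI _ _ u (ltn_ord i) (Qsub i)) _.
  apply: submx_trans (Qsup _ (ltn_ord i)) _.
  apply/sumsmx_subP => j ji; rewrite genmxE; apply/sub_kermxP.
  rewrite mulmxA -row_mul mulmxV // -colE; apply/matrixP => a b; rewrite !mxE.
  by case: eqP => // jk; move: ik ji; rewrite -jk ltnS => /leq_trans h /h; rewrite ltnn.
move/sub_kermxP => /matrixP /(_ 0 0).
by rewrite mulmxA -!row_mul -colE mxE [RHS]mxE mxE.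
Qed.

Lemma diag_mulmx_trig (A B : 'M[R]_n) i :
  is_trig_mx A -> is_trig_mx B -> (A *m B) i i = A i i * B i i.
Proof.
move=> /is_trig_mxP tA /is_trig_mxP tB; rewrite mxE (bigD1 i) //= big1 ?addr0 //.
move=> j ji; case: (ltngtP i j) => [ij|ij|/val_inj ij].
- by rewrite tA // mul0r.
- by rewrite tB // mulr0.
- by rewrite ij eqxx in ji.
Qed.

(** When [Q] triangularizes all ad_u at once, these are the weights of the adjoint
    representation. *)
Definition weight (Q : 'M[R]_n) u i := (Q *m ad_mx br u *m invmx Q) i i.

Lemma killing_weight Q u v : Q \in unitmx ->
  (forall u, is_trig_mx (Q *m ad_mx br u *m invmx Q)) ->
  \tr (ad_mx br u *m ad_mx br v) = \sum_i weight Q u i * weight Q v i.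
Proof.
move=> Qu tQ.
transitivity (\tr ((Q *m ad_mx br u *m invmx Q) *m (Q *m ad_mx br v *m invmx Q))).
  by rewrite !mulmxA mulmxKV // [RHS]mxtrace_mulC !mulmxA mulVmx // mul1mx.
by apply: eq_bigr => i _; rewrite diag_mulmx_trig.
Qed.

(** Diagonals of triangular matrices multiply entrywise, so commutators have zero diagonal;
    linearity extends this to the whole derived algebra. *)
Lemma weight_derived Q w i : Q \in unitmx ->
  (forall u, is_trig_mx (Q *m ad_mx br u *m invmx Q)) ->
  (w <= derived br)%MS -> weight Q w i = 0.
Proof.
move=> Qu tQ wD.
have wtZD a u v : weight Q (a *: u + v) i = a * weight Q u i + weight Q v i.
  rewrite /weight ad_mxZD // mulmxDr mulmxDl -scalemxAr -scalemxAl.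
  by rewrite mxE [X in X + _]mxE.
(* The linear form [weight Q _ i] as a column, so that its vanishing is an inclusion in
   [kermx M]. *)
pose M : 'cV[R]_n := \col_k weight Q (ebasis R k) i.
have wtM u : weight Q u i = (u *m M) 0 0.
  have wt0 : weight Q 0 i = 0.
    by have := wtZD (-1) 0 0; rewrite scaler0 addr0; lra.
  have wtZ a v : weight Q (a *: v) i = a * weight Q v i.
    by rewrite -[a *: v]addr0 wtZD wt0 addr0.
  have wtD v1 v2 : weight Q (v1 + v2) i = weight Q v1 i + weight Q v2 i.
    by rewrite -[v1]scale1r wtZD mul1r scale1r.
  rewrite {1}(row_sum_ebasis u) mxE.
  rewrite (big_morph (fun u => weight Q u i) wtD wt0).
  by apply: eq_bigr => k _; rewrite wtZ mxE.
have DM : (derived br <= kermx M)%MS.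
  apply/sumsmx_subP => a _; apply/sumsmx_subP => b _; rewrite genmxE.
  apply/sub_kermxP; apply/matrixP => x y; rewrite !ord1 -wtM mxE /weight.
  rewrite ad_mx_br // mulmxBr mulmxBl mxE [X in _ + X]mxE.
  have E u v : (Q *m (ad_mx br u *m ad_mx br v) *m invmx Q) i i
      = weight Q u i * weight Q v i.
    by rewrite -diag_mulmx_trig // !mulmxA mulmxKV.
  by rewrite !E mulrC subrr.
by have /sub_kermxP := submx_trans wD DM; rewrite wtM => ->; rewrite mxE.
Qed.

Lemma killing_derived w v :
  (w <= derived br)%MS -> \tr (ad_mx br w *m ad_mx br v) = 0.
Proof.
case: ad_trig => Q Qu tQ wD; rewrite (killing_weight _ _ Qu tQ) big1 // => i _.
by rewrite weight_derived // mul0r.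
Qed.

Lemma killing_ge0 u : 0 <= \tr (ad_mx br u *m ad_mx br u).
Proof.
case: ad_trig => Q Qu tQ; rewrite (killing_weight _ _ Qu tQ).
by apply: sumr_ge0 => i _; rewrite -expr2 sqr_ge0.
Qed.

(** The trace is the sum of the squared real weights of [u], so all weights vanish; they are the
    only eigenvalues of ad_u. *)
Lemma killing0_eigen u x a : \tr (ad_mx br u *m ad_mx br u) = 0 ->
  br u x = a *: x -> x != 0 -> a = 0.
Proof.
case: ad_trig => Q Qu tQ; rewrite (killing_weight _ _ Qu tQ) => kil ux x0.
have wt0 : forall i, weight Q u i = 0.
  apply: sum_sqr_eq0; rewrite -[RHS]kil.
  by apply: eq_bigr => i _; rewrite expr2.
have eig : eigenvalue (Q *m ad_mx br u *m invmx Q) a.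
  apply/eigenvalueP; exists (x *m invmx Q); last first.
    by rewrite -(inj_eq (can_inj (mulmxK Qu))) mulmxKV // mul0mx.
  by rewrite !mulmxA mulmxKV // -br_ad // ux scalemxAl.
move: eig; rewrite eigenvalue_root_char char_poly_trig //.
rewrite -(big_map (fun i => weight Q u i) predT (fun c => 'X - c%:P)) root_prod_XsubC.
by case/mapP => i _ ->; apply: wt0.
Qed.

End CompletelySolvable.


(** * Orthonormalization and null frames in Lorentzian spaces *)

Definition posdef (R : realType) m (S : 'M[R]_m) :=
  S^T = S /\ forall x, x != 0 -> 0 < ipG S x x.

(* Gram-Schmidt: eliminate the first row and orthonormalize the Schur complement. *)
Lemma posdef_orthonormalize_step (R : realType) m (S : 'M[R]_(1 + m)) :
  (forall S' : 'M[R]_m, posdef S' -> exists T : 'M_m, T *m S' *m T^T = 1%:M) ->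
  posdef S -> exists T : 'M_(1 + m), T *m S *m T^T = 1%:M.
Proof.
move=> IH [Ssym Spos].
pose a := S 0 0.
pose b : 'rV_m := ursubmx S.
pose C : 'M_m := drsubmx S.
have defS : S = block_mx a%:M b b^T C :> 'M_(1 + m).
  rewrite -[S in LHS](submxK S); congr block_mx.
    by rewrite [LHS]mx11_scalar !mxE !lshift0.
  by rewrite trmx_ursub Ssym.
have a_gt0 : 0 < a.
  have /Spos : (delta_mx 0 0 : 'rV[R]_(1 + m)) != 0.
    by apply/eqP => /matrixP/(_ 0 0); rewrite !mxE => /eqP; rewrite oner_eq0.
  by rewrite /ipG trmx_delta -rowE -colE !mxE.
have a_neq0 := lt0r_neq0 a_gt0.
have Csym : C^T = C by rewrite trmx_drsub Ssym.
pose C' := C - a^-1 *: (b^T *m b).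
(* The first block corrects the rows of [X] to be [S]-orthogonal to the first basis vector; what
   remains is the Schur complement [C']. *)
have elimC p (X : 'M_(p, m)) :
    row_mx (- a^-1 *: (X *m b^T)) X *m S = row_mx 0 (X *m C').
  rewrite defS mul_row_block mul_mx_scalar scalerA mulrN mulfV // scaleN1r addNr.
  congr row_mx; rewrite /C' mulmxBr -scalemxAr mulmxA -scalemxAl scaleNr.
  by rewrite addrC.
have [|T' T'P] := IH C'; first split=> [|x x0].
- by rewrite linearB linearZ /= trmx_mul trmxK Csym.
- have : (row_mx (- a^-1 *: (x *m b^T)) x : 'rV_(1 + m)) != 0.
    by apply: contra x0 => /eqP h; rewrite -(row_mxKr (- a^-1 *: (x *m b^T)) x) h linear0.
  move/Spos; rewrite /ipG elimC tr_row_mx mul_row_col mul0mx add0r; apply.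
(* Scales the first basis vector, of square norm [a], to unit length. *)
pose s := (Num.sqrt a)^-1.
pose T : 'M_(1 + m) := block_mx s%:M 0 (- a^-1 *: (T' *m b^T)) T'.
have defT : T = col_mx (row_mx s%:M 0) (row_mx (- a^-1 *: (T' *m b^T)) T').
  by rewrite -block_mxEv.
have defTt : T^T = row_mx (col_mx s%:M 0) (col_mx (- a^-1 *: (b *m T'^T)) T'^T).
  rewrite -block_mxEh /T tr_block_mx tr_scalar_mx trmx0 linearZ /=.
  by rewrite trmx_mul trmxK.
have ss : s * a * s = 1.
  by rewrite /s -[a in _ * a * _](sqr_sqrtr (ltW a_gt0)) expr2; field;
    rewrite sqrtr_eq0 -ltNge.
exists T; rewrite {1}defT mul_col_mx elimC defS mul_row_block defTt.
rewrite !mul0mx !addr0 mul_mx_row !mul_col_mx !mul_row_col !mul0mx !mulmx0.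
rewrite !add0r !addr0 T'P -block_mxEh -!scalar_mxM ss -scalemxAr.
rewrite !mul_scalar_mx scalerA.
have -> : - a^-1 * (s * a) = - s by field.
by rewrite scaleNr -scalemxAl addNr -scalar_mx_block.
Qed.

Lemma posdef_orthonormalize (R : realType) m (S : 'M[R]_m) :
  posdef S -> exists T : 'M_m, T *m S *m T^T = 1%:M.
Proof.
elim: m S => [|m IH] S; first by exists 0; rewrite !flatmx0.
exact: posdef_orthonormalize_step.
Qed.

Section NullVector.
Variables (R : realType) (n : nat) (G : 'M[R]_n).
Hypothesis LG : is_lorentzian G.
Local Notation ip := (ipG G).

Lemma lorentzian_sym : G^T = G.
Proof. by case: LG. Qed.

Lemma lorentzian_unit : G \in unitmx.
Proof.
case: LG => _ _ [P [Pu PGP]].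
have : lor_diag R n \in unitmx.
  rewrite unitmxE det_trig; last first.
    by apply/is_trig_mxP => i j ij; rewrite mxE; case: eqP ij => [->|//]; rewrite ltnn.
  rewrite unitfE; apply/prodf_neq0 => i _.
  by rewrite mxE eqxx; case: ifP; rewrite ?oppr_eq0 oner_eq0.
by rewrite -PGP !unitmx_mul => /andP[/andP[]].
Qed.

(** [tau] is the coordinate along the negative direction of a diagonalizing basis; on its kernel the
    form is a sum of squares. *)
Lemma lorentzian_time : exists tau : 'cV[R]_n, forall v : 'rV[R]_n,
  (v *m tau) 0 0 = 0 -> 0 <= ip v v /\ (ip v v = 0 -> v = 0).
Proof.
case: LG => n_gt0 _ [P [Pu PGP]]; pose i0 := Ordinal n_gt0.
exists (invmx P *m (delta_mx i0 0 : 'cV_n)) => v; rewrite mulmxA -colE mxE.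
set y := v *m invmx P => y0.
have vE : v = y *m P by rewrite mulmxKV.
clearbody y; have -> : ip v v = \sum_i y 0 i ^+ 2.
  rewrite vE /ipG trmx_mul !mulmxA -(mulmxA y) -(mulmxA y) PGP mxE.
  apply: eq_bigr => i _; rewrite !mxE (bigD1 i) //= big1 ?addr0; last first.
    by move=> j ji; rewrite !mxE (negPf ji) mulr0.
  rewrite !mxE eqxx; case: ifP => [/eqP i_0|_]; last by rewrite mulr1 expr2.
  have -> : i = i0 by apply: val_inj.
  by rewrite y0 !mulr0 expr0n.
split; first by apply: sumr_ge0 => i _; apply: sqr_ge0.
move=> /sum_sqr_eq0 yi; rewrite vE.
by rewrite (_ : y = 0) ?mul0mx //; apply/rowP => i; rewrite yi mxE.
Qed.

(* Along the null vector [e], translate [v] to a vector with zero time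
   component without changing its square norm. *)
Lemma null_perp e v : e != 0 -> ip e e = 0 -> ip e v = 0 ->
  0 <= ip v v /\ (ip v v = 0 -> exists c, v = c *: e).
Proof.
move=> e0 ee ev; have [tau tauP] := lorentzian_time; have Gsym := lorentzian_sym.
have te : (e *m tau) 0 0 != 0.
  by apply: contra e0 => /eqP /tauP[_ /(_ ee)] ->.
set c := (v *m tau) 0 0 / (e *m tau) 0 0.
have /tauP : ((v - c *: e) *m tau) 0 0 = 0.
  by rewrite mulmxBl -scalemxAl mxE [X in _ + X]mxE [X in - X]mxE divfK // subrr.
rewrite ipDl !(ipDr Gsym) !ipNl !(ipNr Gsym) !ipZl !(ipZr Gsym) ee ev.
rewrite (ipC Gsym v e) ev !mulr0 !oppr0 !addr0 => -[vv vv0]; split=> // /vv0 /eqP.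
by rewrite subr_eq0 => /eqP ->; exists c.
Qed.

Definition null_frame m e f (E : 'M[R]_(m, n)) :=
  [/\ [/\ ip e e = 0, ip f f = 0 & ip e f = 1],
      forall i, ip e (row i E) = 0,
      forall i, ip f (row i E) = 0 &
      forall i j, ip (row i E) (row j E) = (i == j)%:R].

(** Complete [e] to a hyperbolic pair, then orthonormalize the orthogonal complement [W] of the
    pair, on which the form is positive definite. *)
Lemma null_frame_exists e : e != 0 -> ip e e = 0 ->
  exists m f (E : 'M[R]_(m, n)), n = (1 + m + 1)%N /\ null_frame e f E.
Proof.
move=> e0 ee; have Gsym := lorentzian_sym; have Gunit := lorentzian_unit.
have [f [ff ef]] : exists f, ip f f = 0 /\ ip e f = 1.
  have [g eg] : exists g, ip e g != 0.
    pose y := e *m G.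
    have : y != 0 by rewrite -(mul0mx _ G) (inj_eq (can_inj (mulmxK Gunit))).
    case/rV0Pn => j yj; exists (ebasis R j).
    by rewrite /ipG trmx_delta -colE mxE.
  pose h := (ip e g)^-1 *: g.
  have eh : ip e h = 1 by rewrite (ipZr Gsym) mulVf.
  clearbody h.
  (* As <e,h> = 1, subtracting c e lowers the square norm of [h] by 2c and keeps the pairing with
     [e]. *)
  exists (h - (ip h h / 2%:R) *: e).
  rewrite !ipDl !ipNl !ipZl !(ipDr Gsym) !(ipNr Gsym) !(ipZr Gsym) (ipC Gsym h e) ee eh.
  by split; field.
have fe : ip f e = 1 by rewrite (ipC Gsym).
pose X := col_mx e f : 'M_(1 + 1, n).
pose W := kermx (G *m X^T).
have rankX : \rank X = 2%N.
  apply/eqP; rewrite -[_ == _]/(row_free X); apply/row_freeP.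
  (* The Gram matrix of (e, f) against (f, e) is the identity, which gives a right inverse. *)
  exists (G *m (col_mx f e)^T).
  rewrite tr_col_mx mulmxA mul_mx_row /X !mul_col_mx -block_mxEh.
  rewrite [RHS]scalar_mx_block; congr block_mx; apply/matrixP => i j;
    by rewrite !ord1 -[LHS]/(ip _ _) ?ee ?ff ?ef ?fe mxE.
have rankW : n = (\rank W + 2)%N.
  have Gfull : row_full G by rewrite row_full_unit.
  rewrite mxrank_ker (eqmxMfull _ Gfull) mxrank_tr rankX subnK //.
  by rewrite -rankX rank_leq_col.
have perpW v : (v <= W)%MS -> ip e v = 0 /\ ip f v = 0.
  move=> /sub_kermxP; rewrite /X tr_col_mx !mul_mx_row mulmxA mulmxA.
  rewrite -[0](@row_mx0 _ _ 1 1) => /eq_row_mx[ve vf].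
  by rewrite !(ipC Gsym _ v) /ipG ve vf !mxE.
have [B Bfree BW] : exists2 B : 'M_(\rank W, n), row_free B & (B <= W)%MS.
  by exists (row_base W); rewrite ?row_base_free // eq_row_base.
have [|T TP] := @posdef_orthonormalize _ _ (B *m G *m B^T).
  split=> [|x x0]; first by rewrite !trmx_mul trmxK Gsym mulmxA.
  have -> : ipG (B *m G *m B^T) x x = ip (x *m B) (x *m B).
    by rewrite /ipG trmx_mul !mulmxA.
  have [ex fx] : ip e (x *m B) = 0 /\ ip f (x *m B) = 0.
    by apply: perpW; rewrite (submx_trans (submxMl _ _)).
  (* A vector of [W] with zero norm would be c e, and its pairing with [f] forces c = 0. *)
  have [xx xx0] := null_perp e0 ee ex.
  rewrite lt_neqAle xx andbT eq_sym; apply: contra x0 => /eqP /xx0[c xBc].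
  move: fx; rewrite xBc (ipZr Gsym) fe mulr1 => c0; move: xBc.
  rewrite c0 scale0r => /eqP; rewrite mulmx_free_eq0 //.
exists (\rank W), f, (T *m B); split; first by rewrite [LHS]rankW add1n addn1 addn2.
have perpE i : (row i (T *m B) <= W)%MS.
  by rewrite (submx_trans (row_sub _ _)) // (submx_trans (submxMl _ _)).
split=> // [i|i|i j]; try by case: (perpW _ (perpE i)).
transitivity ((T *m B *m G *m (T *m B)^T) i j).
  rewrite /ipG -row_mul mxE [RHS]mxE.
  by apply: eq_bigr => k _; rewrite tr_row; congr (_ * _); rewrite [LHS]mxE.
by rewrite trmx_mul !mulmxA -(mulmxA T) -(mulmxA T) TP mxE.
Qed.

End NullVector.


(** * The Ricci operator and its invariance under isometric isomorphism *)

Section RicciOperator.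
Variables (R : realType) (n : nat) (br : 'rV[R]_n -> 'rV[R]_n -> 'rV[R]_n).
Variable G : 'M[R]_n.
Hypotheses (Lbr : is_lie_bracket br) (Gsym : G^T = G) (Gunit : G \in unitmx).
Local Notation ip := (ipG G).
Implicit Types u v w : 'rV[R]_n.

Lemma ip_Ric u v : ip (Ric br G u) v = ric_form br G u v.
Proof.
pose L u := LCr br G u + ad_mx br u.
(* For fixed [u] and k the curvature acts on its last argument by the matrix [C k]; hence [ric_form]
   is linear there and determined by its values on the basis, which define [Ric]. *)
pose C k := L (br u (ebasis R k))
  - (L (ebasis R k) *m L u - L u *m L (ebasis R k)).
have ricE x : ric_form br G u x = \sum_k (x *m C k) 0 k.
  apply: eq_bigr => k _; congr (fun_of_matrix _ 0 k).
  by rewrite /curv !(LC_LCl Lbr Gsym Gunit) /C !mulmxBr !mulmxA.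
rewrite /Ric {1}/ipG mulmxKV // mxE ricE.
under [RHS]eq_bigr => k _ do rewrite mxE.
rewrite exchange_big /=; apply: eq_bigr => j _.
rewrite !mxE ricE mulrC big_distrr /=; apply: eq_bigr => k _.
by rewrite -rowE [in LHS]mxE.
Qed.

Lemma einsteinP : einstein br G <->
  exists lambda, forall u v, ric_form br G u v = lambda * ip u v.
Proof.
split=> -[lambda RicE]; exists lambda => u; first by move=> v; rewrite -ip_Ric RicE ipZl.
by apply: (ip_nondeg Gunit) => v; rewrite ip_Ric RicE ipZl.
Qed.

Lemma ricci_flatP : (forall u v, ric_form br G u v = 0) -> ricci_flat br G.
Proof.
by move=> ric0 u; apply: (ip_nondeg Gunit) => v; rewrite ip_Ric ric0 ip0l.
Qed.

End RicciOperator.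

Section IsometricIso.
Variables (R : realType) (n : nat) (br1 br2 : 'rV[R]_n -> 'rV[R]_n -> 'rV[R]_n).
Variables (G1 G2 P : 'M[R]_n).
Hypothesis Punit : P \in unitmx.
Hypothesis brP : forall x y, br1 x y *m P = br2 (x *m P) (y *m P).
Hypothesis ipP : forall x y, ipG G2 (x *m P) (y *m P) = ipG G1 x y.

Lemma iso_gram : G2 = invmx P *m G1 *m (invmx P)^T.
Proof.
apply/matrixP => i j; have := ipP (ebasis R i *m invmx P) (ebasis R j *m invmx P).
rewrite !mulmxKV // /ipG !trmx_mul !mulmxA trmx_delta -!mulmxA.
rewrite -!rowE !mulmxA -!colE !mxE => ->.
by apply: eq_bigr => k _; rewrite !mxE.
Qed.

Lemma iso_sym_gram : G1^T = G1 -> G2^T = G2.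
Proof. by move=> G1s; rewrite iso_gram !trmx_mul trmxK G1s mulmxA. Qed.

Lemma iso_unit_gram : G1 \in unitmx -> G2 \in unitmx.
Proof. by move=> G1u; rewrite iso_gram !unitmx_mul unitmx_tr unitmx_inv Punit G1u. Qed.

Lemma br_iso x y : br2 x y = br1 (x *m invmx P) (y *m invmx P) *m P.
Proof. by rewrite brP !mulmxKV. Qed.

Lemma iso_lie : is_lie_bracket br1 -> is_lie_bracket br2.
Proof.
case=> lin skew jac; split=> [a u v w|u v|u v w]; rewrite !br_iso.
- by rewrite mulmxDl -scalemxAl lin mulmxDl -scalemxAl.
- by rewrite skew mulNmx.
- by rewrite !mulmxK // -!mulmxDl jac mul0mx.
Qed.

(** The Koszul formula involves only bracket and form, so [P] transports the Levi-Civita product and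
    curvature; the curvature endomorphisms are then conjugate and have equal traces. *)
Lemma iso_einstein : is_lie_bracket br1 -> G1^T = G1 -> G1 \in unitmx ->
  einstein br1 G1 -> einstein br2 G2.
Proof.
move=> L1 S1 U1; have S2 := iso_sym_gram S1; have U2 := iso_unit_gram U1.
have L2 := iso_lie L1.
move/(einsteinP L1 S1 U1) => [lambda ricE]; apply/(einsteinP L2 S2 U2).
have LC_P x y : LC br1 G1 x y *m P = LC br2 G2 (x *m P) (y *m P).
  apply: (ip_nondeg U2) => w; rewrite -(mulmxKV Punit w) ipP.
  by rewrite (ip_LC L1 S1 U1) (ip_LC L2 S2 U2) -!brP !ipP.
have curvP u w v : curv br1 G1 u w v *m P = curv br2 G2 (u *m P) (w *m P) (v *m P).
  by rewrite /curv !mulmxBl !LC_P brP.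
have ricP u v : ric_form br1 G1 u v = ric_form br2 G2 (u *m P) (v *m P).
  rewrite (ric_form_curvmx L1 S1 U1) (ric_form_curvmx L2 S2 U2).
  set C1 := curvmx _ _ u v; set C2 := curvmx _ _ _ _.
  have C12 : C1 *m P = P *m C2.
    apply/row_matrixP => i; rewrite !rowE !mulmxA.
    by rewrite -(curv_curvmx L1 S1 U1) -(curv_curvmx L2 S2 U2) curvP.
  by rewrite -(mulmxK Punit C1) C12 mxtrace_mulC mulKmx.
exists lambda => u v.
by rewrite -(mulmxKV Punit u) -(mulmxKV Punit v) -ricP ricE ipP.
Qed.

End IsometricIso.

Lemma isometric_iso_dim (R : realType) (n N : nat) (P : 'M[R]_(n, N)) :
  bijective (fun x : 'rV[R]_n => x *m P) -> n = N.
Proof.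
case=> Q PQ QP.
have /eqP <- : row_free P.
  by apply: inj_row_free => v vP; apply: (can_inj PQ); rewrite vP mul0mx.
have /eqP : row_full P.
  rewrite -sub1mx; apply/row_subP => i; rewrite -(QP (row i 1%:M)).
  exact: submxMl.
by [].
Qed.

Lemma isometric_iso_einstein (R : realType) (n N : nat)
  (br1 : 'rV[R]_n -> 'rV[R]_n -> 'rV[R]_n) (G1 : 'M[R]_n)
  (br2 : 'rV[R]_N -> 'rV[R]_N -> 'rV[R]_N) (G2 : 'M[R]_N) (P : 'M[R]_(n, N)) :
  is_lie_bracket br1 -> G1^T = G1 -> G1 \in unitmx ->
  isometric_iso br1 G1 br2 G2 P ->
  is_lie_bracket br2 /\ (einstein br1 G1 <-> einstein br2 G2).
Proof.
move=> L1 S1 U1 [bijP brP ipP]; have nN := isometric_iso_dim bijP; subst N.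
have Punit : P \in unitmx.
  case: bijP => Q PQ _; rewrite -row_free_unit.
  by apply: inj_row_free => v vP; apply: (can_inj PQ); rewrite vP mul0mx.
have L2 := iso_lie Punit brP L1; split=> //; split.
  exact: (iso_einstein Punit brP ipP).
apply: (@iso_einstein _ _ br2 br1 G2 G1 (invmx P)) => //.
- by rewrite unitmx_inv.
- by move=> x y; rewrite (br_iso Punit brP) mulmxK.
- by move=> x y; rewrite -ipP !mulmxKV.
- exact: (iso_sym_gram Punit ipP S1).
- exact: (iso_unit_gram Punit ipP U1).
Qed.


(** * Double-extension coordinates and calculus in a null frame *)

Lemma de_mk_eta (R : realType) m (x : 'rV[R]_(1 + m + 1)) :
  x = de_mk (de_a x) (de_u x) (de_c x).
Proof.
by rewrite /de_mk /de_a /de_u /de_c -!mx11_scalar !hsubmxK.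
Qed.

Lemma de_aE (R : realType) m a (u : 'rV[R]_m) c : de_a (de_mk a u c) = a.
Proof. by rewrite /de_a /de_mk !row_mxKl mxE. Qed.

Lemma de_uE (R : realType) m a (u : 'rV[R]_m) c : de_u (de_mk a u c) = u.
Proof. by rewrite /de_u /de_mk row_mxKl row_mxKr. Qed.

Lemma de_cE (R : realType) m a (u : 'rV[R]_m) c : de_c (de_mk a u c) = c.
Proof. by rewrite /de_c /de_mk row_mxKr mxE. Qed.

Lemma dot0E (R : realType) m (u v : 'rV[R]_m) : dot0 u v = \sum_i u 0 i * v 0 i.
Proof. by rewrite /dot0 mxE; apply: eq_bigr => i _; rewrite mxE. Qed.

(** Rows follow the storage order (a, u, c), so right multiplication turns double-extension
    coordinates into vectors, with [f] as ebar. *)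
Definition frame_mx (R : realType) m n (e f : 'rV[R]_n) (E : 'M[R]_(m, n)) :
  'M[R]_(1 + m + 1, n) := col_mx (col_mx e E) f.

Lemma mul_frame_mx (R : realType) m n (e f : 'rV[R]_n) (E : 'M[R]_(m, n)) x :
  x *m frame_mx e f E = de_a x *: e + de_u x *m E + de_c x *: f.
Proof.
rewrite {1}(de_mk_eta x) /de_mk /frame_mx !mul_row_col.
by rewrite !mul_scalar_mx.
Qed.

Section Frame.
Variables (R : realType) (n m : nat) (G : 'M[R]_n) (e f : 'rV[R]_n) (E : 'M[R]_(m, n)).
Hypotheses (Gsym : G^T = G) (Gunit : G \in unitmx).
Hypotheses (dim : n = (1 + m + 1)%N) (frame : null_frame G e f E).
Local Notation ip := (ipG G).
Local Notation E_ i := (row i E).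
Implicit Types u v w : 'rV[R]_n.

Let ee : ip e e = 0. Proof. by case: frame => -[]. Qed.
Let ff : ip f f = 0. Proof. by case: frame => -[]. Qed.
Let ef : ip e f = 1. Proof. by case: frame => -[]. Qed.
Let fe : ip f e = 1. Proof. by rewrite (ipC Gsym). Qed.
Let eE i : ip e (E_ i) = 0. Proof. by case: frame. Qed.
Let fE i : ip f (E_ i) = 0. Proof. by case: frame. Qed.
Let EE i j : ip (E_ i) (E_ j) = (i == j)%:R. Proof. by case: frame. Qed.

Lemma ip_frame_sum (x : 'rV[R]_m) w : ip w (x *m E) = \sum_i x 0 i * ip w (E_ i).
Proof.
rewrite mulmx_sum_row (ip_sumr Gsym).
by apply: eq_bigr => i _; rewrite (ipZr Gsym).
Qed.

Lemma ip_frame_mx x y : ip (x *m frame_mx e f E) (y *m frame_mx e f E) = de_ip x y.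
Proof.
have we w (z : 'rV_m) : (forall i, ip w (E_ i) = 0) -> ip w (z *m E) = 0.
  by move=> wE; rewrite ip_frame_sum big1 // => i _; rewrite wE mulr0.
have EEs (z z' : 'rV_m) : ip (z *m E) (z' *m E) = dot0 z z'.
  rewrite ip_frame_sum dot0E; apply: eq_bigr => i _; rewrite mulrC; congr (_ * _).
  rewrite (ipC Gsym) ip_frame_sum (bigD1 i) //= EE eqxx mulr1 big1 ?addr0 // => j ji.
  by rewrite EE eq_sym (negPf ji) mulr0.
rewrite !mul_frame_mx !ipDl !(ipDr Gsym) !ipZl !(ipZr Gsym) EEs ee ff ef fe.
rewrite !(ipC Gsym (_ *m E)) !we // /de_ip; ring.
Qed.

(** A vanishing combination pairs to zero under [de_ip] with everything; testing against e, ebar and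
    its own middle part kills each coordinate. *)
Lemma frame_mx_free : row_free (frame_mx e f E).
Proof.
apply: inj_row_free => x x0.
have ipx y : de_ip x y = 0 by rewrite -ip_frame_mx x0 ip0l.
have := ipx (de_mk 1 0 0); have := ipx (de_mk 0 0 1); have := ipx (de_mk 0 (de_u x) 0).
rewrite /de_ip !de_aE !de_uE !de_cE !mulr0 !mulr1 !add0r !addr0.
rewrite /dot0 trmx0 !mulmx0 !mxE !addr0 => uu a0 c0.
suff u0 : de_u x = 0.
  by rewrite (de_mk_eta x) a0 u0 c0 /de_mk raddf0 !row_mx0.
apply/rowP => i; rewrite [RHS]mxE; move: i; apply: sum_sqr_eq0.
by rewrite -[RHS]uu; apply: eq_bigr => j _; rewrite [X in _ = _ * X]mxE expr2.
Qed.

Lemma frame_ext u v : ip u e = ip v e -> ip u f = ip v f ->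
  (forall i, ip u (E_ i) = ip v (E_ i)) -> u = v.
Proof.
move=> uve uvf uvE; apply: (ip_nondeg Gunit) => w.
have /submxP[x ->] : (w <= frame_mx e f E)%MS.
  by apply: submx_full; rewrite /row_full (eqP frame_mx_free) -dim.
rewrite mul_frame_mx !(ipDr Gsym) !(ipZr Gsym) uve uvf !ip_frame_sum.
by do 2 congr (_ + _); apply: eq_bigr => i _; rewrite uvE.
Qed.

(** [e] and [f] are dual to each other, hence the crossed coefficients. *)
Lemma frame_decomp v :
  v = ip v f *: e + ip v e *: f + \sum_i ip v (E_ i) *: E_ i.
Proof.
apply: frame_ext => [||i]; rewrite !ipDl !ipZl ip_suml ?ee ?ff ?ef ?fe ?eE ?fE.
- by rewrite big1 => [|i _]; [ring | rewrite ipZl (ipC Gsym _ e) eE mulr0].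
- by rewrite big1 => [|i _]; [ring | rewrite ipZl (ipC Gsym _ f) fE mulr0].
rewrite (bigD1 i) //= big1 => [|j ji]; first by rewrite ipZl EE eqxx /=; ring.
by rewrite ipZl EE (negPf ji) mulr0.
Qed.

Lemma ip_frame u v :
  ip u v = ip u f * ip v e + ip u e * ip v f + \sum_i ip u (E_ i) * ip v (E_ i).
Proof.
rewrite {1}(frame_decomp u) !ipDl !ipZl ip_suml (ipC Gsym e) (ipC Gsym f).
by congr (_ + _); apply: eq_bigr => i _; rewrite ipZl (ipC Gsym _ v).
Qed.

(** [frame_decomp] writes the identity as a sum [M] of rank-one matrices, each contributing one
    pairing to the trace. *)
Lemma mxtrace_frame (A : 'M[R]_n) :
  \tr A = ip (e *m A) f + ip (f *m A) e + \sum_i ip (E_ i *m A) (E_ i).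
Proof.
pose M := G *m f^T *m e + G *m e^T *m f + \sum_i G *m (E_ i)^T *m E_ i.
have M1 : M = 1%:M.
  apply/row_matrixP => i; rewrite !rowE mulmx1 [RHS]frame_decomp.
  rewrite /M !mulmxDr !mulmxA mulmx_sumr.
  have scal (w z : 'rV[R]_n) : delta_mx 0 i *m G *m w^T *m z = ip (delta_mx 0 i) w *: z.
    by rewrite {1}[_ *m w^T]mx11_scalar mul_scalar_mx.
  rewrite !scal; congr (_ + _); apply: eq_bigr => j _.
  by rewrite !mulmxA scal.
have tr_ip w z : \tr (G *m w^T *m z *m A) = ip (z *m A) w.
  by rewrite -mulmxA mxtrace_mulC mulmxA /ipG /mxtrace big_ord1.
rewrite -[A in LHS]mul1mx -M1 /M !mulmxDl mulmx_suml !mxtraceD !tr_ip raddf_sum /=.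
by congr (_ + _); apply: eq_bigr => i _; rewrite tr_ip.
Qed.

End Frame.


(** * The Einstein equations in a null frame adapted to the derived algebra *)

Section DegenerateEinstein.
Variables (R : realType) (n m : nat) (br : 'rV[R]_n -> 'rV[R]_n -> 'rV[R]_n).
Variables (G : 'M[R]_n) (e f : 'rV[R]_n) (E : 'M[R]_(m, n)) (lambda : R).
Local Notation ip := (ipG G).
Local Notation E_ i := (row i E).
Local Notation ad := (ad_mx br).
Hypotheses (Lbr : is_lie_bracket br) (CS : completely_solvable br).
Hypothesis Ubr : unimodular br.
Hypotheses (Gsym : G^T = G) (Gunit : G \in unitmx).
Hypotheses (dim : n = (1 + m + 1)%N) (frame : null_frame G e f E).
Hypothesis e_derived : (e <= derived br)%MS.
Hypothesis e_perp : forall x, (x <= derived br)%MS -> ip e x = 0.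
Hypothesis ricE : forall u v, ric_form br G u v = lambda * ip u v.
Implicit Types u v w : 'rV[R]_n.

Let ee : ip e e = 0. Proof. by case: frame => -[]. Qed.
Let ef : ip e f = 1. Proof. by case: frame => -[]. Qed.
Let eE i : ip e (E_ i) = 0. Proof. by case: frame. Qed.
Let EE i j : ip (E_ i) (E_ j) = (i == j)%:R. Proof. by case: frame. Qed.

Let e_br u v : ip e (br u v) = 0.
Proof. exact/e_perp/br_derived. Qed.

Let br_e u v : ip (br u v) e = 0.
Proof. by rewrite (ipC Gsym). Qed.

Let e0 : e != 0.
Proof. by apply/eqP => e0; move/eqP: ef; rewrite e0 ip0l eq_sym oner_eq0. Qed.

Let coad_e : coad br G e = 0.
Proof.
apply: (ip_mx_inj Gunit) => u v.
by rewrite (ip_coad Lbr Gsym Gunit) e_br mulmx0 ip0l.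
Qed.

(** Brackets are orthogonal to [e], so they have no [f]-component and their [e]-components pair to
    zero. *)
Lemma ip_br_frame u v w z :
  ip (br u v) (br w z) = \sum_i ip (br u v) (E_ i) * ip (br w z) (E_ i).
Proof.
by rewrite (ip_frame Gsym Gunit dim frame) !br_e mulr0 mul0r !add0r.
Qed.

Lemma mxtrace_ad_adj u v : \tr (ad u *m adjmx G (ad v)) =
  ip (br u e) (br v f) + ip (br u f) (br v e)
  + \sum_i ip (br u (E_ i)) (br v (E_ i)).
Proof.
have ipE x y : ip (x *m (ad u *m adjmx G (ad v))) y = ip (br u x) (br v y).
  by rewrite mulmxA (ipC Gsym) -(ip_adj Gsym Gunit) -!(br_ad Lbr) (ipC Gsym).
rewrite (mxtrace_frame Gsym Gunit dim frame) !ipE.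
by congr (_ + _); apply: eq_bigr => i _; rewrite ipE.
Qed.

Lemma brE_e i : br e (E_ i) = ip (br e (E_ i)) f *: e.
Proof.
have := ricE e e; rewrite (ric_formE Lbr Gsym Gunit Ubr) ee mulr0.
rewrite (killing_derived Lbr CS _ e_derived) coad_e mul0mx mxtrace0.
rewrite mxtrace_ad_adj (brxx Lbr) ip0l ip0r // => ric_ee.
have sum0 : \sum_i ip (br e (E_ i)) (br e (E_ i)) = 0 by lra.
have sq_ge0 j : ip (br e (E_ j)) (br e (E_ j)) >= 0.
  by rewrite ip_br_frame sumr_ge0 // => k _; rewrite -expr2 sqr_ge0.
(* A zero square norm kills only the E-components; the [e]-component survives until [br_eE]. *)
have := sum_ge0_eq0 sq_ge0 sum0 i; rewrite ip_br_frame.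
under eq_bigr => k _ do rewrite -expr2.
move/sum_sqr_eq0 => eEE.
rewrite {1}(frame_decomp Gsym Gunit dim frame (br e (E_ i))) br_e scale0r addr0.
by rewrite big1 ?addr0 // => j _; rewrite eEE scale0r.
Qed.

(** In ric(e,f) only <[e,f],[f,e]> survives; skewness of the bracket makes its contribution
    positive. *)
Lemma lambdaE : lambda = 2%:R^-1 * \sum_i ip (br e f) (E_ i) ^+ 2.
Proof.
have := ricE e f; rewrite (ric_formE Lbr Gsym Gunit Ubr) ef mulr1.
rewrite (killing_derived Lbr CS _ e_derived) coad_e mul0mx mxtrace0.
rewrite mxtrace_ad_adj (brxx Lbr) ip0l big1 => [|i _]; last first.
  by rewrite brE_e ipZl e_br mulr0.
rewrite (brC Lbr f e) (ipNr Gsym) ip_br_frame.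
under eq_bigr => i _ do rewrite -expr2.
by move=> h; lra.
Qed.

(** The last two terms come from tr(J^2) with J = [coad br G (E_ i)]: skew-adjointness turns it into
    minus the trace of the Gram form of J, where the hyperbolic pair enters with the opposite sign
    since [f,e] = -[e,f]. *)
Lemma ric_EE i : lambda =
  - 2%:R^-1 * \tr (ad (E_ i) *m ad (E_ i))
  - 2%:R^-1 * (\sum_k \sum_j ip (br (E_ i) (E_ k)) (E_ j) ^+ 2)
  - 2%:R^-1 * ip (br e f) (E_ i) ^+ 2
  + 4%:R^-1 * (\sum_k \sum_j ip (br (E_ k) (E_ j)) (E_ i) ^+ 2).
Proof.
have := ricE (E_ i) (E_ i); rewrite EE eqxx mulr1 => <-.
rewrite (ric_formE Lbr Gsym Gunit Ubr) mxtrace_ad_adj.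
have brEe k u v : ip (br (E_ k) e) (br u v) = 0.
  by rewrite (brC Lbr) brE_e ipNl ipZl e_br mulr0 oppr0.
rewrite (ipC Gsym (br _ f)) !brEe !add0r.
under [X in _ - _ * X - _]eq_bigr => k _ do rewrite ip_br_frame.
have ipcoad := ip_coad Lbr Gsym Gunit.
have ip_coad2 x y : ip (x *m (coad br G (E_ i) *m coad br G (E_ i))) y
    = - ip (x *m coad br G (E_ i)) (y *m coad br G (E_ i)).
  by rewrite mulmxA (ip_adj Gsym Gunit) (adj_coad Lbr Gsym Gunit) mulmxN (ipNr Gsym).
have Ee k : ip (E_ i) (br e (E_ k)) = 0.
  by rewrite brE_e (ipZr Gsym) (ipC Gsym _ e) eE mulr0.
have Ee' k : ip (E_ i) (br (E_ k) e) = 0 by rewrite (brC Lbr) (ipNr Gsym) Ee oppr0.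
have ip_coad_coad x y : ip (x *m coad br G (E_ i)) (y *m coad br G (E_ i)) =
    ip (E_ i) (br x f) * ip (E_ i) (br y e) + ip (E_ i) (br x e) * ip (E_ i) (br y f)
    + \sum_j ip (E_ i) (br x (E_ j)) * ip (E_ i) (br y (E_ j)).
  rewrite [LHS](ip_frame Gsym Gunit dim frame) !ipcoad.
  by congr (_ + _); apply: eq_bigr => j _; rewrite !ipcoad.
have -> : \tr (coad br G (E_ i) *m coad br G (E_ i)) =
    2%:R * ip (br e f) (E_ i) ^+ 2 - \sum_k \sum_j ip (br (E_ k) (E_ j)) (E_ i) ^+ 2.
  rewrite (mxtrace_frame Gsym Gunit dim frame) !ip_coad2 !ip_coad_coad -sumrN.
  rewrite !(brxx Lbr) (ip0r Gsym) big1 => [|k _]; last by rewrite Ee mul0r.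
  rewrite big1 => [|k _]; last by rewrite Ee mulr0.
  rewrite (brC Lbr f e) (ipNr Gsym) (ipC Gsym (E_ i)).
  congr (_ + _); first by ring.
  apply: eq_bigr => k _; rewrite ip_coad2 ip_coad_coad.
  rewrite Ee' mulr0 mul0r !add0r; congr (- _); apply: eq_bigr => j _.
  by rewrite -expr2 (ipC Gsym).
have sumE : \sum_k \sum_j ip (br (E_ i) (E_ k)) (E_ j) * ip (br (E_ i) (E_ k)) (E_ j)
  = \sum_k \sum_j ip (br (E_ i) (E_ k)) (E_ j) ^+ 2.
  by apply: eq_bigr => k _; apply: eq_bigr => j _; rewrite expr2.
by rewrite sumE; field.
Qed.

Lemma einstein_vanish :
  [/\ lambda = 0, forall i, ip (br e f) (E_ i) = 0,
      forall i j k, ip (br (E_ i) (E_ j)) (E_ k) = 0 &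
      forall i, \tr (ad (E_ i) *m ad (E_ i)) = 0].
Proof.
set W := \sum_i ip (br e f) (E_ i) ^+ 2.
set B := \sum_i \tr (ad (E_ i) *m ad (E_ i)).
set C := \sum_i \sum_j \sum_k ip (br (E_ i) (E_ j)) (E_ k) ^+ 2.
have W_ge0 : 0 <= W by apply: sumr_ge0 => i _; apply: sqr_ge0.
have B_ge0 : 0 <= B by apply: sumr_ge0 => i _; apply: killing_ge0.
have C_ge0 : 0 <= C.
  by do 3![apply: sumr_ge0 => ? _]; apply: sqr_ge0.
have lambda_ge0 : 0 <= lambda by rewrite lambdaE -/W; lra.
(* After reindexing, both triple sums equal [C], with net coefficient -1/4; the right side is
   therefore nonpositive and the left nonnegative. *)
have trace_eq : lambda *+ m = - 2%:R^-1 * B - 2%:R^-1 * C - 2%:R^-1 * W + 4%:R^-1 * C.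
  have -> : lambda *+ m = \sum_(i < m) lambda by rewrite sumr_const card_ord.
  rewrite (eq_bigr _ (fun i _ => ric_EE i)).
  rewrite !big_split /= !sumrN -!mulr_sumr -/W -/B -/C; congr (_ + _ * _).
  rewrite exchange_big; apply: eq_bigr => i _ /=.
  by rewrite exchange_big.
have : 0 <= lambda *+ m by apply: mulrn_wge0.
rewrite trace_eq => lambda_m_ge0.
have W0 : W = 0 by lra.
have B0 : B = 0 by lra.
have C0 : C = 0 by lra.
split.
(* Read off from [W], since [lambda *+ m] carries no information when m = 0. *)
- by rewrite lambdaE -/W W0 mulr0.
- exact: sum_sqr_eq0.
- move=> i j; apply: sum_sqr_eq0; move: j; apply: sum_ge0_eq0 => [j|].
    by apply: sumr_ge0 => k _; apply: sqr_ge0.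
  move: i; apply: sum_ge0_eq0 C0 => i.
  by do 2![apply: sumr_ge0 => ? _]; apply: sqr_ge0.
- by apply: sum_ge0_eq0 B0 => i; apply: killing_ge0.
Qed.

(** The double-extension parameters, with [f] as ebar: pairing with [f] extracts [e]-components,
    pairing with the rows of [E] extracts components in the abelian part. *)
Let mu := ip (br f e) f.
Let D : 'M[R]_m := \matrix_(i, j) ip (br f (E_ i)) (E_ j).
Let K : 'M[R]_m := \matrix_(i, j) ip (br (E_ i) (E_ j)) f.
Let b : 'rV[R]_m := \row_j ip (br f (E_ j)) f.

Let br_decomp u v : br u v =
  ip (br u v) f *: e + \sum_i ip (br u v) (E_ i) *: E_ i.
Proof.
by rewrite {1}(frame_decomp Gsym Gunit dim frame (br u v)) br_e scale0r addr0.
Qed.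

Let br_fe : br f e = mu *: e.
Proof.
have [_ efE _ _] := einstein_vanish.
rewrite br_decomp big1 ?addr0 // => i _.
by rewrite (brC Lbr) ipNl efE oppr0 scale0r.
Qed.

Let br_EE i j : br (E_ i) (E_ j) = K i j *: e.
Proof.
have [_ _ EEE _] := einstein_vanish.
by rewrite br_decomp big1 ?addr0 ?mxE // => k _; rewrite EEE scale0r.
Qed.

(** [e] is an eigenvector of the adjoint map of [E_ i], whose weights all vanish. *)
Let br_eE i : br e (E_ i) = 0.
Proof.
have [_ _ _ B0] := einstein_vanish; rewrite brE_e.
have Ee : br (E_ i) e = - ip (br e (E_ i)) f *: e.
  by rewrite (brC Lbr) {1}brE_e scaleNr.
have /eqP := killing0_eigen Lbr CS (B0 i) Ee e0.
by rewrite oppr_eq0 => /eqP ->; rewrite scale0r.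
Qed.

(** The trace of ad_f in the frame is [mu + \tr D], and unimodularity makes it zero. *)
Let muE : mu = - \tr D.
Proof.
have := Ubr f; rewrite (mxtrace_frame Gsym Gunit dim frame) -!(br_ad Lbr).
rewrite (brxx Lbr) ip0l addr0 -/mu => /eqP; rewrite addr_eq0 => /eqP ->.
by congr (- _); apply: eq_bigr => i _; rewrite mxE -(br_ad Lbr).
Qed.

Lemma skewK : K^T = - K.
Proof. by apply/matrixP => i j; rewrite !mxE (brC Lbr) ipNl. Qed.

Let br_e_rowE (u : 'rV[R]_m) : br e (u *m E) = 0.
Proof.
rewrite mulmx_sum_row (br_sumr Lbr) big1 // => i _.
by rewrite (brZr Lbr) br_eE scaler0.
Qed.

Let br_f_rowE (u : 'rV[R]_m) : br f (u *m E) = dot0 b u *: e + u *m D *m E.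
Proof.
rewrite (mulmx_sum_row u E) (mulmx_sum_row (u *m D)) (br_sumr Lbr) dot0E.
under eq_bigr => i _ do rewrite (brZr Lbr) br_decomp scalerDr scalerA scaler_sumr.
rewrite big_split /= -scaler_suml; congr (_ *: _ + _).
  by apply: eq_bigr => i _; rewrite mxE mulrC.
rewrite exchange_big; apply: eq_bigr => j _ /=.
rewrite mxE scaler_suml; apply: eq_bigr => i _.
by rewrite scalerA mxE.
Qed.

Let br_rowE_rowE (u v : 'rV[R]_m) :
  br (u *m E) (v *m E) = dot0 (u *m K) v *: e.
Proof.
rewrite (mulmx_sum_row u E) (mulmx_sum_row v E) (br_suml Lbr) dot0E.
under eq_bigr => i _ do rewrite (br_sumr Lbr).
rewrite exchange_big scaler_suml; apply: eq_bigr => j _ /=.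
rewrite mxE mulr_suml scaler_suml; apply: eq_bigr => i _.
by rewrite (brZl Lbr) (brZr Lbr) br_EE !scalerA mulrAC.
Qed.

Lemma br_frame_mx x y : br (x *m frame_mx e f E) (y *m frame_mx e f E) =
  de_br K D (- \tr D) b x y *m frame_mx e f E.
Proof.
rewrite !mul_frame_mx -muE /de_br de_aE de_uE de_cE.
rewrite !(brDl Lbr) !(brDr Lbr) !(brZl Lbr) !(brZr Lbr) !(brxx Lbr).
rewrite (brC Lbr _ e) (brC Lbr e f) (brC Lbr (_ *m E) f).
rewrite !br_e_rowE !br_f_rowE br_rowE_rowE br_fe mulmxBl -!scalemxAl.
move: (de_u x *m D *m E) (de_u y *m D *m E) => U V.
by apply/rowP => k; rewrite !mxE; ring.
Qed.

Lemma degenerate_einstein :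
  lambda = 0 /\
  exists (K D : 'M[R]_m) (b : 'rV[R]_m), K^T = - K /\
    forall x y, br (x *m frame_mx e f E) (y *m frame_mx e f E) =
      de_br K D (- \tr D) b x y *m frame_mx e f E.
Proof.
split; first by case: einstein_vanish.
by exists K, D, b; split; [exact: skewK | exact: br_frame_mx].
Qed.

End DegenerateEinstein.

(** * The model metric and the characterization of Einstein algebras *)

Lemma ip_de_G (R : realType) m (x y : 'rV[R]_(1 + m + 1)) :
  ipG (de_G R m) x y = de_ip x y.
Proof.
have ipC0 (u v : 'rV[R]_(1 + m + 1)) : de_ip u v = de_ip v u.
  rewrite /de_ip !dot0E addrC [in RHS]addrC; congr (_ + _).
    by apply: eq_bigr => i _; rewrite mulrC.
  by rewrite addrC; congr (_ + _); rewrite mulrC.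
have ip_lin a (u v w : 'rV[R]_(1 + m + 1)) : de_ip (a *: u + v) w = a * de_ip u w + de_ip v w.
  rewrite /de_ip /dot0.
  have -> : de_a (a *: u + v) = a * de_a u + de_a v by rewrite /de_a !mxE.
  have -> : de_c (a *: u + v) = a * de_c u + de_c v by rewrite /de_c !mxE.
  have -> : de_u (a *: u + v) = a *: de_u u + de_u v by rewrite /de_u !linearP.
  rewrite mulmxDl -scalemxAl; move: (de_u u *m _) (de_u v *m _) => U V.
  by rewrite !mxE; ring.
have ip0 (w : 'rV[R]_(1 + m + 1)) : de_ip 0 w = 0.
  by have := ip_lin (-1) 0 0 w; rewrite scaler0 addr0; lra.
have ip_sum (F : 'I_(1 + m + 1) -> R) w :
    de_ip (\sum_i F i *: ebasis R i) w = \sum_i F i * de_ip (ebasis R i) w.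
  have ipD (u v : 'rV[R]_(1 + m + 1)) : de_ip (u + v) w = de_ip u w + de_ip v w.
    by rewrite -[u]scale1r ip_lin mul1r scale1r.
  rewrite (big_morph (fun u => de_ip u w) ipD (ip0 w)).
  by apply: eq_bigr => i _; rewrite -[_ *: _]addr0 ip_lin ip0 addr0.
rewrite [in RHS](row_sum_ebasis x) ip_sum /ipG mxE.
under eq_bigr => j _ do rewrite !mxE big_distrl /=.
rewrite exchange_big; apply: eq_bigr => i _ /=.
rewrite [in RHS](row_sum_ebasis y) ipC0 ip_sum big_distrr /=; apply: eq_bigr => j _.
by rewrite !mxE ipC0; ring.
Qed.

Theorem theorem4p3 (R : realType) (n : nat)
  (br : 'rV[R]_n -> 'rV[R]_n -> 'rV[R]_n) (G : 'M[R]_n) :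
  is_lie_bracket br -> is_lorentzian G ->
  completely_solvable br -> unimodular br ->
  degenerate_on G (derived br) ->
  (einstein br G <->
     exists (m : nat) (K D : 'M[R]_m) (b : 'rV[R]_m),
       admissible K D (- \tr D) b /\
       exists P : 'M[R]_(n, 1 + m + 1),
         isometric_iso br G (de_br K D (- \tr D) b) (de_G R m) P)
  /\ (einstein br G -> ricci_flat br G).
Proof.
move=> Lbr LG CS Ubr [e [e0 eD eperp]].
have Gsym := lorentzian_sym LG; have Gunit := lorentzian_unit LG.
(* [e] lies in the derived algebra and is orthogonal to it, hence is null. *)
have [m [f [E [dim frame]]]] := null_frame_exists LG e0 (eperp e eD).
have main : einstein br G -> ricci_flat br G /\
    exists (K D : 'M[R]_m) (b : 'rV[R]_m), K^T = - K /\
      forall x y, br (x *m frame_mx e f E) (y *m frame_mx e f E) =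
        de_br K D (- \tr D) b x y *m frame_mx e f E.
  move/(einsteinP Lbr Gsym Gunit) => [lambda ricE].
  have [lambda0 KDb] :=
    degenerate_einstein Lbr CS Ubr Gsym Gunit dim frame eD eperp ricE.
  split=> //; apply: (ricci_flatP Lbr Gsym Gunit) => u v.
  by rewrite ricE lambda0 mul0r.
split; last by move/main => [].
split=> [ein|[m' [K [D [b [[_ _ ein] [P isoP]]]]]]]; last first.
  by apply: (proj2 (proj2 (isometric_iso_einstein Lbr Gsym Gunit isoP))).
have [_ [K [D [b [skewK brE]]]]] := main ein.
exists m, K, D, b.
have ipE := ip_frame_mx Gsym frame; have Qfree := frame_mx_free Gsym frame.
have [P isoP] : exists P : 'M[R]_(n, 1 + m + 1),
    isometric_iso br G (de_br K D (- \tr D) b) (de_G R m) P.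
  (* Identifying the dimensions makes the frame matrix square; its inverse sends vectors to their
     coordinates and is the required [P]. *)
  clear main ein skewK eperp eD frame; subst n.
  have Qunit : frame_mx e f E \in unitmx by rewrite -row_free_unit.
  exists (invmx (frame_mx e f E)); split=> [|x y|x y].
  - by exists (mulmx^~ (frame_mx e f E)) => x; rewrite ?mulmxKV ?mulmxK.
  - by rewrite -{1}(mulmxKV Qunit x) -{1}(mulmxKV Qunit y) brE mulmxK.
  - by rewrite ip_de_G -ipE !mulmxKV.
(* Admissibility is transported along [P]: the Jacobi identity and the Einstein condition of the
   model come from the given algebra. *)
have [Lde einE] := isometric_iso_einstein Lbr Gsym Gunit isoP.
by split; [split=> //; apply/einE | exists P].
Qed.
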